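(* There exists a real number $a$ such that the iterated function system $\mathcal{S} = \{S_1, S_2, S_3\}$ on $\mathbb{R}$ given by $$S_1(x) = \frac{x}{7}, \qquad S_2(x) = \frac{x}{7} + a, \qquad S_3(x) = \frac{x}{7} + \frac{6}{7},$$ with attractor $K$, has all of the following properties: (i) $0, 1 \in K \subset [0,1]$, $K \neq [0,1]$, and $0 < \dim_H(K) < 1$; (ii) $\mathcal{S}$ satisfies the weak separation property, the open set condition, and the finite type condition; (iii) $\mathcal{S}$ satisfies neither the convex open set condition nor the convex finite type condition.
   Context: Let $\mathcal{S} = \{S_1, \dots, S_n\}$ be maps $S_i : \mathbb{R} \to \mathbb{R}$ of the form $S_i(x) = r x + d_i$ with a common ratio $0 < r < 1$ (an equicontractive iterated function system, IFS). The attractor $K$ is the unique non-empty compact set with $K = \bigcup_{i=1}^n S_i(K)$. $\dim_H$ denotes Hausdorff dimension, and $\mathrm{hull}(K)$ denotes the convex hull of $K$, with $\mathrm{int}$ the topological interior in $\mathbb{R}$. For $k \ge 0$ let $\Sigma^k = \{1, \dots, n\}^k$ and $\Sigma^* = \bigcup_{k \ge 0} \Sigma^k$. For $\sigma = s_1 s_2 \cdots s_k \in \Sigma^k$ write $S_\sigma = S_{s_1} \circ S_{s_2} \circ \cdots \circ S_{s_k}$ (the identity if $k=0$). For $\sigma, \tau \in \Sigma^k$ of the same length, $S_\sigma^{-1} \circ S_\tau(x) = x + a_{\sigma,\tau}$ for a real number $a_{\sigma,\tau}$. Weak separation property (WSP): $\inf \{ |a_{\sigma,\tau}| : k \ge 0,\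 \sigma, \tau \in \Sigma^k,\ a_{\sigma,\tau} \ne 0 \} > 0$. Open set condition (OSC): there exists a non-empty open set $V \subset \mathbb{R}$ such that $S_i(V) \subset V$ for all $i$ and $S_i(V) \cap S_j(V) = \emptyset$ for all $i \ne j$. Convex open set condition: the OSC holds with the particular choice $V = \mathrm{int}(\mathrm{hull}(K))$. Finite type condition (FTC): let $V$ be a non-empty open set with $S_i(V) \subset V$ for all $i$. Words $\sigma, \tau \in \Sigma^k$ of the same length are neighbours (with respect to $V$) if $S_\sigma(V) \cap S_\tau(V) \ne \emptyset$ (in this case $S_\tau$ is also called a neighbour of $S_\sigma$). The neighbourhood type of $S_\sigma$, for $\sigma \in \Sigma^k$, is $N(S_\sigma) = \{ S_\sigma^{-1} \circ S_\tau : \tau \in \Sigma^k,\ S_\tau \text{ is a neighbour of } S_\sigma \}$. $\mathcal{S}$ satisfies the FTC if there exists such an open set $V$ for which there are only finitely many distinct neighbourhood types $N(S_\sigma)$ as $\sigma$ ranges over $\Sigma^*$. Convex finite type condition: the FTC holds with the particular choice $V = \mathrm{int}(\mathrm{hull}(K))$. *)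

(* Defs.v *)
From HB Require Import structures.
From mathcomp Require Import all_boot all_order all_algebra.
From mathcomp Require Import all_classical all_reals all_analysis.

Set Implicit Arguments.
Unset Strict Implicit.
Unset Printing Implicit Defensive.

Import Order.TTheory GRing.Theory Num.Theory.
Import numFieldNormedType.Exports.

Local Open Scope classical_set_scope.
Local Open Scope ring_scope.

(* The explicit 0 makes the diameter of the empty set 0 instead of -oo. *)
Definition diameter (R : realType) (A : set R) : \bar R :=
  ereal_sup ([set 0%E] `|` [set `|x - y|%:E | x in A & y in A]).

(* diam(A)^s, where the empty set has weight 0 also for s = 0, while a
   singleton has weight 0^0 = 1 (so that H^0 is the counting measure). *)
Definition hausdorff_weight (R : realType) (s : R) (A : set R) : \bar R :=
  if `[< A = set0 >] then 0%E else poweR (diameter A) s.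

(* Covers are indexed by nat; since empty sets have weight 0, these include
   the finite covers. *)
Definition hausdorff_premeasure (R : realType) (s delta : R) (A : set R)
    : \bar R :=
  ereal_inf [set (\sum_(k <oo) hausdorff_weight s (F k))%E
            | F in [set F : nat -> set R |
                     A `<=` \bigcup_k F k /\
                     forall k, (diameter (F k) <= delta%:E)%E]].

(* The premeasures increase as delta decreases to 0, so the supremum is the
   limit as delta tends to 0. *)
Definition hausdorff_measure (R : realType) (s : R) (A : set R) : \bar R :=
  ereal_sup [set hausdorff_premeasure s delta A | delta in [set t : R | 0 < t]].

Definition hausdorff_dim (R : realType) (A : set R) : \bar R :=
  ereal_inf [set s%:E | s in [set s : R | 0 <= s /\ hausdorff_measure s A = 0%E]].

Definition convex_hull (R : realType) (A : set R) : set R :=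
  smallest (fun C : set (convex_lmodType R^o) => convex_set C) A.

(* An iterated function system on R is a family S : 'I_n -> R -> R. The
   notions below that mention inverses are meant for systems of maps
   x |-> r * x + d_i with a common r <> 0. *)

Definition attractor (R : realType) (n : nat) (S : 'I_n -> R -> R) : set R -> Prop :=
  unique (fun K : set R =>
    [/\ K !=set0, compact K & K = \bigcup_(i in [set: 'I_n]) (S i @` K)]).

Definition wordmap (R : realType) (n : nat) (S : 'I_n -> R -> R) (w : seq 'I_n)
    : R -> R :=
  foldr (fun i f => S i \o f) id w.

(* S_sigma^-1 \o S_tau. Here pinv setT f is the two-sided inverse of f, as
   f = S_sigma is a bijection of R. *)
Definition relmap (R : realType) (n : nat) (S : 'I_n -> R -> R)
    (sigma tau : seq 'I_n) : R -> R :=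
  pinv setT (wordmap S sigma) \o wordmap S tau.

Definition translation_numbers (R : realType) (n : nat) (S : 'I_n -> R -> R) : set R :=
  [set a : R | exists (k : nat) (sigma tau : k.-tuple 'I_n),
                 relmap S sigma tau = (fun x => x + a)].

(* The infimum is taken in \bar R, so that it is +oo on the empty set. *)
Definition weak_separation (R : realType) (n : nat) (S : 'I_n -> R -> R) : Prop :=
  (0 < ereal_inf [set `|a|%:E | a in translation_numbers S `\ 0%R])%E.

Definition osc_for (R : realType) (n : nat) (S : 'I_n -> R -> R) (V : set R) : Prop :=
  [/\ open V, V !=set0,
      forall i, S i @` V `<=` V
    & forall i j, i != j -> S i @` V `&` S j @` V = set0].

Definition open_set_condition (R : realType) (n : nat) (S : 'I_n -> R -> R) : Prop :=
  exists V : set R, osc_for S V.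

Definition convex_open_set_condition (R : realType) (n : nat) (S : 'I_n -> R -> R)
    (K : set R) : Prop :=
  osc_for S (convex_hull K)°.

Definition neighbours (R : realType) (n : nat) (S : 'I_n -> R -> R) (V : set R)
    (k : nat) (sigma tau : k.-tuple 'I_n) : Prop :=
  wordmap S sigma @` V `&` wordmap S tau @` V !=set0.

Definition nbhd_type (R : realType) (n : nat) (S : 'I_n -> R -> R) (V : set R)
    (k : nat) (sigma : k.-tuple 'I_n) : set (R -> R) :=
  [set relmap S sigma tau | tau in [set tau : k.-tuple 'I_n | neighbours S V sigma tau]].

Definition ftc_for (R : realType) (n : nat) (S : 'I_n -> R -> R) (V : set R) : Prop :=
  [/\ open V, V !=set0,
      forall i, S i @` V `<=` V
    & finite_set [set N : set (R -> R) |
        exists (k : nat) (sigma : k.-tuple 'I_n), N = nbhd_type S V sigma]].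

Definition finite_type_condition (R : realType) (n : nat) (S : 'I_n -> R -> R) : Prop :=
  exists V : set R, ftc_for S V.

Definition convex_finite_type_condition (R : realType) (n : nat)
    (S : 'I_n -> R -> R) (K : set R) : Prop :=
  ftc_for S (convex_hull K)°.

(* Main.v *)
Require Import Defs.
From HB Require Import structures.
From mathcomp Require Import all_boot all_order all_algebra.
From mathcomp Require Import all_classical all_reals all_analysis.
From mathcomp Require Import ring lra zify.

Set Implicit Arguments.
Unset Strict Implicit.
Unset Printing Implicit Defensive.

Import Order.TTheory GRing.Theory Num.Theory.
Import numFieldNormedType.Exports.

Local Open Scope classical_set_scope.
Local Open Scope ring_scope.

(* With [b = 7 a], the digits are [0, b, 6]. If [b] itself has an expansion
   [b = sum_k c_k / 7 ^ k] in base 7 with digits [c_k] in [{6, b}], then its tails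
   [t_k] satisfy [t_0 = b] and [t_(k+1) = 7 t_k - c_k] and stay in [[b/6, 1[].
   For [6/7 < b < 1], the only digit difference keeping [7 t_k + d_j - d_i] in
   [[-1, 1]] is [- c_k], so up to sign the [t_k] are the only nonzero translation
   numbers in [[-1, 1]].
   A small interval [U] in the middle gap of [K] is such that no [t_k] moves a
   point of the orbit [V] of [U] into [U], nor a point of [U] into [V]; hence
   [V] and [V + t_k] are disjoint, and [V] satisfies the open set condition,
   which implies the weak separation property and the finite type condition.
   On the other hand every [t_k] lies in a neighbourhood type for [V = ]0, 1[].
   Placing the digits [b] at the square positions makes the [t_k] accumulate at 1
   from below, so that there are infinitely many types. *)

(** * Iterated function systems and the open set condition *)

Lemma bij_wordmap (R : realType) (n : nat) (S : 'I_n -> R -> R) :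
  (forall i, bijective (S i)) -> forall w, bijective (wordmap S w).
Proof.
move=> Sbij; elim=> [|i w IHw] /=; first by exists id.
exact: bij_comp (Sbij i) IHw.
Qed.

Lemma wordmap_cat (R : realType) (n : nat) (S : 'I_n -> R -> R) v w x :
  wordmap S (v ++ w) x = wordmap S v (wordmap S w x).
Proof. by elim: v => //= i v ->. Qed.

Lemma relmapK (R : realType) (n : nat) (S : 'I_n -> R -> R) :
  (forall i, bijective (S i)) ->
  forall v w x, wordmap S v (relmap S v w x) = wordmap S w x.
Proof.
move=> Sbij v w x; have [g _ gK] := bij_wordmap Sbij v.
by apply: pinvK; rewrite inE; exists (g (wordmap S w x)).
Qed.

Lemma relmap_eq (R : realType) (n : nat) (S : 'I_n -> R -> R) :
  (forall i, bijective (S i)) ->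
  forall v w x y, wordmap S w x = wordmap S v y -> relmap S v w x = y.
Proof.
move=> Sbij v w x y wv; apply: (bij_inj (bij_wordmap Sbij v)).
by rewrite relmapK.
Qed.

Lemma osc_wordmap_sub (R : realType) (n : nat) (S : 'I_n -> R -> R) (V : set R) :
  osc_for S V -> forall w, wordmap S w @` V `<=` V.
Proof.
move=> [_ _ SV _]; elim=> [|i w IHw] _ [x Vx <-] //=.
by apply: SV; exists (wordmap S w x) => //; apply: IHw; exists x.
Qed.

(** Tails of words keep points of [V] inside [V], so disjointness forces equal first letters, and
    the injective first map cancels. *)
Lemma osc_wordmap_disjoint (R : realType) (n : nat) (S : 'I_n -> R -> R)
    (V : set R) :
  (forall i, bijective (S i)) -> osc_for S V ->
  forall v w x y, size v = size w -> V x -> V y ->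
    wordmap S v x = wordmap S w y -> v = w.
Proof.
move=> Sbij oscV v w x y svw Vx Vy; have [_ _ _ Sdisj] := oscV.
elim: v w svw => [|i v IHv] [|j w] //= [svw] /= vw.
have VS u z : V z -> V (wordmap S u z).
  by move=> Vz; apply: (osc_wordmap_sub oscV (w := u)); exists z.
have [ij|/Sdisj ij] := eqVneq i j; last first.
  have : (S i @` V `&` S j @` V) (S i (wordmap S v x)).
    by split; [exists (wordmap S v x)|exists (wordmap S w y)] => //; exact: VS.
  by rewrite ij.
rewrite {i}ij in vw *; congr cons; apply: IHv svw _.
exact: (bij_inj (Sbij j)).
Qed.

(** A word has no neighbour of its length but itself, so [[set id]] is the only type. *)
Lemma osc_ftc (R : realType) (n : nat) (S : 'I_n -> R -> R) (V : set R) :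
  (forall i, bijective (S i)) -> osc_for S V -> ftc_for S V.
Proof.
move=> Sbij oscV; have [Vo V0 SV _] := oscV; split=> //.
apply: (@sub_finite_set _ _ [set [set id]]) => // _ [k [v ->]] /=.
have relid : relmap S v v = id by apply/funext => x; exact: relmap_eq.
apply/seteqP; split=> [_ [w + <-]|_ ->].
  move=> [_ [[x Vx <-] [y Vy yx]]].
  have wv := osc_wordmap_disjoint Sbij oscV _ Vy Vx yx.
  by rewrite /= (_ : w = v)//; apply/val_inj/wv; rewrite !size_tuple.
by exists v => //; have [x Vx] := V0; exists (wordmap S v x); split; exists x.
Qed.

(* If [V] contains the ball of radius [e] around [x], then a translation number
   [a] with [0 < |a| < e] would make [S_sigma V] and [S_tau V] meet. *)
Lemma osc_wsp (R : realType) (n : nat) (S : 'I_n -> R -> R) (V : set R) :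
  (forall i, bijective (S i)) -> osc_for S V -> weak_separation S.
Proof.
move=> Sbij oscV; have [Vo [x Vx] SV _] := oscV.
have /nbhs_ballP[e /= e0 eV] := open_nbhs_nbhs (conj Vo Vx).
apply: (@lt_le_trans _ _ e%:E); first by rewrite lte_fin.
apply/ereal_infP => _ [a [[k [v [w vw]]] a0] <-].
rewrite lee_fin leNgt; apply/negP => ae; apply: a0 => /=.
have Vxa : V (x + a).
  by apply: eV; rewrite /ball/= opprD addNKr normrN.
have vwx z : relmap S v w z = z + a by rewrite vw.
have xvw : wordmap S w x = wordmap S v (x + a) by rewrite -vwx relmapK.
have wv : tval w = tval v.
  by apply: (osc_wordmap_disjoint Sbij oscV _ Vx Vxa xvw); rewrite !size_tuple.
move: (xvw); rewrite wv => /(bij_inj (bij_wordmap Sbij v)) xxa.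
by apply: (addrI x); rewrite addr0.
Qed.

(** * The attractor of an equicontractive system *)

Definition equi (R : realType) (n : nat) (r : R) (d : 'I_n -> R) (i : 'I_n)
    (x : R) : R :=
  r * x + d i.

Lemma bij_equi (R : realType) (n : nat) (r : R) (d : 'I_n -> R) i :
  r != 0 -> bijective (equi r d i).
Proof.
move=> r0; exists (fun y => (y - d i) / r) => x; rewrite /equi.
  by rewrite addrK mulrC mulKf.
by rewrite mulrC divfK// subrK.
Qed.

Definition hutchinson (R : realType) (n : nat) (S : 'I_n -> R -> R) (A : set R) : set R :=
  \bigcup_(i in [set: 'I_n]) (S i @` A).

Definition level (R : realType) (n : nat) (S : 'I_n -> R -> R) (k : nat) : set R :=
  iter k (hutchinson S) `[0, 1]%classic.

Definition limit_set (R : realType) (n : nat) (S : 'I_n -> R -> R) : set R :=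
  \bigcap_k level S k.

Section Attractor.
Context (R : realType) (n : nat) (r : R) (d : 'I_n -> R).
Hypotheses (r_gt0 : 0 < r) (r_lt1 : r < 1).
(** Each map sends [[0, 1]] into itself, so the levels decrease. *)
Hypothesis d_bound : forall i, 0 <= d i <= 1 - r.

Local Notation S := (equi r d).

Lemma levelS k x : level S k.+1 x <-> exists i y, level S k y /\ x = r * y + d i.
Proof.
split=> [[i _ [y ky <-]]|[i [y [ky ->]]]]; first by exists i, y.
by exists i => //; exists y.
Qed.

Lemma level_decr k : level S k.+1 `<=` level S k.
Proof.
elim: k => [x /levelS[i [y [/=]]]|k IHk x /levelS[i [y [ky ->]]]].
  rewrite !in_itv/= => /andP[y0 y1 ->]; have /andP[d0 d1] := d_bound i.
  have ry0 : 0 <= r * y by rewrite mulr_ge0// ltW.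
  have ry1 : r * y <= r by rewrite ler_piMr// ltW.
  by apply/andP; split; lra.
by apply/levelS; exists i, y; split=> //; apply: IHk.
Qed.

Lemma level_sub k l : (k <= l)%N -> level S l `<=` level S k.
Proof.
move=> /subnK <-; elim: (l - k)%N => // m IHm.
by apply: subset_trans IHm; rewrite addSn; exact: level_decr.
Qed.

Lemma limit_set_sub01 : limit_set S `<=` `[0, 1].
Proof. by move=> x /(_ 0%N); exact. Qed.

Lemma limit_setE : limit_set S = hutchinson S (limit_set S).
Proof.
apply/seteqP; split=> [x Kx|_ [i _ [y Ky <-]] k _]; last first.
  by apply: level_decr; apply/levelS; exists i, y; split=> //; exact: Ky.
pose P i k := level S k ((x - d i) / r).
have Pdecr i k l : (k <= l)%N -> P i l -> P i k by move=> /level_sub; apply.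
have exP k : exists i, P i k.
  have /levelS[i [y [ky xE]]] := Kx k.+1 I.
  by exists i; rewrite /P xE addrK mulrC mulKf// gt_eqF.
(* If every first letter [i] failed at some level [f i], none would survive at the largest [f i], as
   the levels decrease. *)
have [i Pi] : exists i, forall k, P i k.
  apply: contrapT => /forallNP /= notP.
  have /choice[f Pf] i : exists k, ~ P i k by apply/existsNP.
  have [i Pi] := exP (\max_i f i)%N.
  by apply: (Pf i); apply: Pdecr Pi; exact: leq_bigmax.
exists i => //; exists ((x - d i) / r); first by move=> k _; exact: Pi.
by rewrite /equi mulrC divfK ?subrK// gt_eqF.
Qed.

Lemma level_compact k : compact (level S k).
Proof.
elim: k => [|k IHk]; first exact: segment_compact.
apply: (subclosed_compact _ (@segment_compact R 0 1)).
- apply: closed_bigcup => [|i _]; first exact: finite_finset.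
  apply: compact_closed => //; apply: (@continuous_compact _ _ _ (level S k)) => //.
  apply: continuous_subspaceT => x; rewrite /equi.
  by apply: cvgD; [apply: cvgM; [exact: cvg_cst|exact: cvg_id]|exact: cvg_cst].
- exact: (@level_sub 0).
Qed.

Lemma limit_set_compact : compact (limit_set S).
Proof.
apply: (subclosed_compact _ (@segment_compact R 0 1) limit_set_sub01).
by apply: closed_bigI => k _; apply: compact_closed => //; exact: level_compact.
Qed.

Lemma limit_set_addressed k x : level S k x ->
  exists w y, [/\ size w = k, `[0, 1]%classic y & x = wordmap S w y].
Proof.
elim: k x => [|k IHk] x; first by exists [::], x.
move=> /levelS[i [z [/IHk[w [y [sw y01 ->]]] ->]]].
by exists (i :: w), y; rewrite /= sw.
Qed.

Lemma wordmap_dist w x y :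
  wordmap S w x - wordmap S w y = r ^+ size w * (x - y).
Proof.
elim: w => [|i w IHw] /=; first by rewrite expr0 mul1r.
by rewrite exprS -mulrA -IHw /equi; ring.
Qed.

Lemma wordmap_hutchinson A : A = hutchinson S A -> forall w x, A x -> A (wordmap S w x).
Proof.
move=> AE; elim=> [|i w IHw] x Ax //=.
by rewrite AE; exists i => //; exists (wordmap S w x) => //; exact: IHw.
Qed.

Lemma expr_lt_eps (D e : R) : 0 < e -> exists k, r ^+ k * D < e.
Proof.
move=> e0; have D1 : 0 < `|D| + 1 by rewrite ltr_wpDl.
have r_cvg : (fun k => r ^+ k) @ \oo --> (0 : R).
  by apply: cvg_expr; rewrite ger0_norm// ltW.
have /cvgrPdist_lt/(_ _ (divr_gt0 e0 D1)) [k _ /(_ k (leqnn k)) /=] := r_cvg.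
rewrite sub0r normrN ger0_norm ?exprn_ge0 ?ltW// ltr_pdivlMr// => rk.
exists k; apply: le_lt_trans rk; apply: ler_wpM2l.
  by rewrite exprn_ge0// ltW.
by rewrite (le_trans (ler_norm D))// lerDl.
Qed.

(** Applying the fixed-point equation k times shrinks an a priori bound [D] on [A] to the error
    [r ^+ k * D] on both sides of [[0, 1]]. *)
Lemma hutchinson_fixed_sub01 A :
  compact A -> A = hutchinson S A -> A `<=` `[0, 1].
Proof.
move=> cA AE; have [M [Mreal Mb]] := compact_bounded cA.
pose D := `|M| + 1.
have AD x : A x -> - D <= x <= D.
  by move=> Ax; rewrite -ler_norml; apply: Mb => //; rewrite /D; case: (ler0P M) => ?; lra.
have D0 : 0 <= D by rewrite /D addr_ge0.
have Ak k : A `<=` [set x | - (r ^+ k * D) <= x <= 1 + r ^+ k * D].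
  elim: k => [|k IHk] x.
    by rewrite expr0 mul1r => /AD /andP[Dx xD] /=; apply/andP; split; lra.
  rewrite {1}AE => -[i _ [y /IHk/= /andP[yl yr] <-]].
  have /andP[d0 d1] := d_bound i; rewrite exprS /equi.
  have ryl : r * - (r ^+ k * D) <= r * y by rewrite ler_wpM2l// ltW.
  have ryr : r * y <= r * (1 + r ^+ k * D) by rewrite ler_wpM2l// ltW.
  by apply/andP; split; lra.
move=> x Ax; rewrite /= in_itv/=; apply/andP; split; rewrite leNgt; apply/negP => x0.
  have xpos : 0 < - x by rewrite oppr_gt0.
  have [k] := expr_lt_eps D xpos.
  by have /andP[+ _] := Ak k _ Ax; lra.
have xpos : 0 < x - 1 by rewrite subr_gt0.
have [k] := expr_lt_eps D xpos.
by have /andP[_ +] := Ak k _ Ax; lra.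
Qed.

Lemma limit_set_attractor : limit_set S !=set0 -> attractor S (limit_set S).
Proof.
move=> K0; split=> [|A [[a Aa] cA AE]].
  by split; [|exact: limit_set_compact|exact: limit_setE].
have A01 := hutchinson_fixed_sub01 cA AE.
apply/seteqP; split=> [x Kx|x Ax k _]; last first.
  elim: k x Ax => [|k IHk] x Ax; first exact: A01.
  move: Ax; rewrite AE => -[i _ [y Ay <-]].
  by apply/levelS; exists i, y; split=> //; exact: IHk.
(* A point of the limit set with address [w] of length k is within [r ^+ k] of [wordmap S w a],
   which lies in the closed set [A]. *)
have /closure_id-> : closed A by exact: compact_closed.
move=> B /nbhs_ballP[e /= e0 eB].
have [k ke] := expr_lt_eps 1 e0; rewrite mulr1 in ke.
have [w [y [sw y01 xE]]] := limit_set_addressed (Kx k I).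
exists (wordmap S w a); split; first exact: wordmap_hutchinson.
apply: eB; rewrite /ball/= xE wordmap_dist sw normrM.
rewrite (ger0_norm (exprn_ge0 _ (ltW r_gt0))) (le_lt_trans _ ke)//.
rewrite -[leRHS]mulr1; apply: ler_wpM2l; first by rewrite exprn_ge0// ltW.
move: y01 (A01 _ Aa); rewrite /= !in_itv/= => /andP[y0 y1] /andP[a0 a1].
by rewrite ler_norml; apply/andP; split; lra.
Qed.

End Attractor.

(** * Expansions in base 7 *)

Section Adic.
Context (R : realType).
Implicit Types u : nat -> R.

Definition adic u : R := limn (series (fun k => u k / 7 ^+ k.+1)).

Definition shift k u : nat -> R := fun j => u (k + j)%N.

(** This geometric series dominates all expansions with digits in [[0, M]]. *)
Let geo_cvg (M : R) : series (geometric (M / 7) 7^-1) @ \oo --> M / 6.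
Proof.
have -> : M / 6 = M / 7 / (1 - 7^-1) by field.
by apply: cvg_geometric_series; rewrite ger0_norm; lra.
Qed.

Let term_bound (M : R) u : (forall k, 0 <= u k <= M) ->
  forall k, 0 <= u k / 7 ^+ k.+1 <= geometric (M / 7) 7^-1 k.
Proof.
move=> uM k; have /andP[u0 uk] := uM k; rewrite divr_ge0//=.
by rewrite exprS invfM mulrA -exprVn ler_wpM2r// ler_wpM2r.
Qed.

Let adic_is_cvg (M : R) u : (forall k, 0 <= u k <= M) ->
  cvgn (series (fun k => u k / 7 ^+ k.+1)).
Proof.
move=> uM; apply: (@series_le_cvg _ _ (geometric (M / 7) 7^-1)) => [k|k|k|].
- by have /andP[] := term_bound uM k.
- by have /andP[u0 /(le_trans u0)] := term_bound uM k.
- by have /andP[] := term_bound uM k.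
- by apply/cvg_ex; exists (M / 6); exact: (@geo_cvg M).
Qed.

Lemma adic_bound (M : R) u : (forall k, 0 <= u k <= M) -> 0 <= adic u <= M / 6.
Proof.
move=> uM; apply/andP; split.
  apply: limr_ge; first exact: (adic_is_cvg uM).
  near=> n; apply: sumr_ge0 => k _.
  by have /andP[] := term_bound uM k.
rewrite -(cvg_lim _ (@geo_cvg M))//; apply: lim_series_le => [||k].
- exact: (adic_is_cvg uM).
- by apply/cvg_ex; exists (M / 6); exact: (@geo_cvg M).
- by have /andP[] := term_bound uM k.
Unshelve. all: by end_near. Qed.

Lemma adic_rec (M : R) u : (forall k, 0 <= u k <= M) ->
  adic u = (u 0%N + adic (shift 1 u)) / 7.
Proof.
move=> uM; apply: cvg_lim => //.
rewrite -cvg_shiftS.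
have -> : [sequence series (fun k => u k / 7 ^+ k.+1) n.+1]_n =
    (fun n => (u 0%N + series (fun k => shift 1 u k / 7 ^+ k.+1) n) / 7).
  apply/funext => n; rewrite /series/= big_nat_recl// expr1 mulrDl; congr +%R.
  rewrite mulr_suml; apply: eq_bigr => k _.
  by rewrite /shift add1n [7 ^+ k.+2]exprS invfM mulrA mulrAC -mulrA.
apply: cvgM; last exact: cvg_cst.
apply: cvgD; first exact: cvg_cst.
by apply: (@adic_is_cvg M) => k; exact: uM.
Qed.

Lemma adic_shift_rec (M : R) u k : (forall k, 0 <= u k <= M) ->
  adic (shift k u) = (u k + adic (shift k.+1 u)) / 7.
Proof.
move=> uM; rewrite (@adic_rec M) => [|j]; last exact: uM.
rewrite /shift addn0; congr ((_ + adic _) / _).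
by apply/funext => j; rewrite addnA addn1.
Qed.

End Adic.

(** * Expansions with digit 1 at the square positions *)

Section Squares.
Context (R : realType).

(** Squares start at 1: position 0 is free, so the expansion of [b] begins with the digit 6, whence
    [6 / 7 < b]. *)
Definition square_digit (k : nat) : R :=
  (`[< exists j, k = (j.+1 ^ 2)%N >])%:R.

Local Notation u := square_digit.

Lemma square_digit_bound k : 0 <= u k <= 1.
Proof. by rewrite /square_digit; case: asboolP; rewrite lexx ler01. Qed.

Lemma square_digit01 k : u k = 0 \/ u k = 1.
Proof. by rewrite /square_digit; case: asboolP; [right|left]. Qed.

Definition square_tail k : R := adic (shift k u).

Lemma square_tail_bound k : 0 <= square_tail k <= 1 / 6.
Proof. by apply: adic_bound => j; exact: square_digit_bound. Qed.

Lemma square_tail_rec k : square_tail k = (u k + square_tail k.+1) / 7.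
Proof. by apply: (@adic_shift_rec _ 1); exact: square_digit_bound. Qed.

(** Some square lies at or after every position, and positivity passes back from there along the
    recursion. *)
Lemma square_tail_gt0 k : 0 < square_tail k.
Proof.
have tail_sq j : 0 < square_tail (j.+1 ^ 2)%N.
  rewrite square_tail_rec /square_digit; case: asboolP => [_|[]]; last by exists j.
  by have /andP[] := square_tail_bound (j.+1 ^ 2).+1; rewrite /= mulr1n; lra.
have tailD j m : 0 < square_tail (m + j) -> 0 < square_tail m.
  elim: j m => [|j IHj] m; first by rewrite addn0.
  rewrite addnS -addSn => /IHj; rewrite [square_tail m]square_tail_rec.
  by have /andP[] := square_digit_bound m; lra.
have /subnKC kE : (k <= k.+1 ^ 2)%N by rewrite expnS expn1; nia.
by apply: (@tailD (k.+1 ^ 2 - k)%N); rewrite kE.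
Qed.

(** Consecutive squares drift apart: at least [j] zeros follow position [j.+1 ^ 2], so the tail
    there is at most [7^-1 ^+ j]. *)
Lemma square_tail_small (e : R) : 0 < e -> exists k, square_tail k < e.
Proof.
move=> e0.
have run j i : (i <= j)%N ->
    square_tail (j.+1 ^ 2).+1 = square_tail ((j.+1 ^ 2).+1 + i)%N * 7^-1 ^+ i.
  elim: i => [|i IHi] ij; first by rewrite addn0 expr0 mulr1.
  rewrite IHi 1?ltnW// square_tail_rec {1}/square_digit.
  case: asboolP => [[l jil]|_]; last by rewrite addnS exprS /= mulr0n; ring.
  have [lj|lj] := leqP l j.
    by have : (l.+1 ^ 2 <= j.+1 ^ 2)%N; [rewrite leq_sqr|rewrite -jil; lia].
  have : (j.+2 ^ 2 <= l.+1 ^ 2)%N by rewrite leq_sqr.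
  by rewrite -jil !expnS !expn0; lia.
have [||j ej] := @expr_lt_eps R 7^-1 _ _ 1 e e0; [lra|lra|].
exists (j.+1 ^ 2).+1; rewrite (@run j j)//; apply: le_lt_trans ej.
rewrite mulrC ler_wpM2l ?exprn_ge0//.
by have /andP[] := square_tail_bound ((j.+1 ^ 2).+1 + j); lra.
Qed.

End Squares.

(** * The open set condition for the example *)

Section Example.
Context (R : realType).

(* With [alpha = square_tail 0], this is the solution of
   [b = 6 (1/6 - alpha) + b alpha]: digit [b] at the square
   positions (counted from 0), digit [6] elsewhere. *)
Definition digit : R := (1 - 6 * square_tail R 0) / (1 - square_tail R 0).

Local Notation b := digit.

(* The tail [t_k] of the expansion of [b]. *)
Definition gap (k : nat) : R := 1 - (6 - b) * square_tail R k.

Definition offset (i : 'I_3) : R :=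
  match nat_of_ord i with 0 => 0 | 1 => b / 7 | _ => 6 / 7 end.

Local Notation S := (equi 7^-1 offset).

Let tail0_bound : 0 < square_tail R 0 <= 1 / 42.
Proof.
rewrite square_tail_gt0/= square_tail_rec /square_digit.
case: asboolP => [[j]|_]; first by rewrite expnS expn1; lia.
by have /andP[] := square_tail_bound R 1; rewrite /= mulr0n; lra.
Qed.

Lemma digit_bound : 6 / 7 < b < 1.
Proof.
have /andP[t0 t1] := tail0_bound.
by rewrite /b ltr_pdivlMr ?ltr_pdivrMr; [apply/andP; split; lra|lra|lra].
Qed.

Lemma gap0 : gap 0 = b.
Proof.
have /andP[t0 t1] := tail0_bound.
have : b * (1 - square_tail R 0) = 1 - 6 * square_tail R 0.
  by rewrite /b divfK// gt_eqF//; lra.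
by rewrite /gap; lra.
Qed.

(** The ends are the expansions with all digits [b] and with all digits 6; the latter is never
    reached, since a digit [b] always recurs. *)
Lemma gap_bound k : b / 6 <= gap k < 1.
Proof.
have /andP[b0 b1] := digit_bound; have /andP[t0 t1] := square_tail_bound R k.
have tk0 := square_tail_gt0 R k; rewrite /gap.
have : 0 < (6 - b) * square_tail R k by rewrite mulr_gt0//; lra.
have : (6 - b) * square_tail R k <= (6 - b) * (1 / 6) by rewrite ler_wpM2l//; lra.
by move=> ? ?; apply/andP; split; lra.
Qed.

(** The leading digit of the tail is [b] in the first case and 6 in the second. *)
Lemma gap_cases k :
  (gap k <= (1 + b) / 7 /\ gap k.+1 = 7 * gap k - b) \/
  ((6 + b / 6) / 7 <= gap k /\ gap k.+1 = 7 * gap k - 6).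
Proof.
have /andP[g0 g1] := gap_bound k.+1.
have tE := square_tail_rec R k.
have gE : gap k.+1 = 7 * gap k - 6 + (6 - b) * square_digit R k.
  by rewrite /gap tE; field.
by have [uk|uk] := square_digit01 R k; rewrite uk in gE; [right|left]; split; lra.
Qed.

Lemma gap_near1 (e : R) : 0 < e -> exists k, 1 - e < gap k.
Proof.
move=> e0; have /andP[b0 b1] := digit_bound.
have [|k ke] := @square_tail_small R (e / 6); first by rewrite divr_gt0.
exists k; have tk0 := square_tail_gt0 R k; rewrite /gap.
have : 0 < b * square_tail R k by rewrite mulr_gt0//; lra.
by lra.
Qed.

Lemma bij_S i : bijective (S i).
Proof. by apply: bij_equi; rewrite invr_eq0 pnatr_eq0. Qed.

(* The interval left free in [[0, 1]] by [I_2 + t] and [I_3 - t] for the [t_k] in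
   [[b/6, (1 + b)/7]], where [I_i = S_i [0, 1]]. *)
Definition core : set R := [set x | (2 + 2 * b) / 7 < x < (5 - b) / 7].

Definition core_orbit : set R :=
  [set x | exists w y, core y /\ x = wordmap S w y].

Lemma core_orbit_cases x : core_orbit x ->
  core x \/ exists i y, core_orbit y /\ x = 7^-1 * y + offset i.
Proof.
move=> [[|i w] [y [Uy ->]]]; first by left.
by right; exists i, (wordmap S w y); split=> //; exists w, y.
Qed.

Lemma core_orbit_S i x : core_orbit x -> core_orbit (S i x).
Proof. by move=> [w [y [Uy ->]]]; exists (i :: w), y. Qed.

Lemma core_orbit_itv x : core_orbit x -> 0 < x < 1.
Proof.
have /andP[b0 b1] := digit_bound.
move=> [w [y [/andP[y0 y1] ->]]]; elim: w => [|i w]/=.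
  by apply/andP; split; lra.
rewrite /equi; move: (wordmap S w y) => z /andP[z0 z1].
by case: i => [[|[|[|i]]] //= ?]; rewrite /offset/=; apply/andP; split; lra.
Qed.

(** Points outside the core lie in some [I_i]; the overlapping [I_1] and [I_2] are merged into one
    case. *)
Lemma core_orbit_sub x : core_orbit x -> x < (1 + b) / 7 \/ core x \/ 6 / 7 < x.
Proof.
have /andP[b0 b1] := digit_bound.
move=> /core_orbit_cases[Ux|[i [y [/core_orbit_itv/andP[y0 y1] ->]]]]; first by right; left.
case: i => [[|[|[|i]]] //= ?]; rewrite /offset/=.
- by left; lra.
- by left; lra.
- by right; right; lra.
Qed.

(** Induction on the word leading to [x], for all [k] at once: removing one letter from both points
    replaces [t_k] by [t_(k+1)]. *)
Lemma core_orbit_gap k x : core_orbit x -> core_orbit (x + gap k) -> False.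
Proof.
have /andP[b0 b1] := digit_bound.
move=> [w [z [Uz {x}->]]]; elim: w k => [|i w IHw] k /=.
  (* A tail with leading digit [b] moves the core strictly between itself and [I_3]; one with
     leading digit 6 moves it beyond 1. *)
  move=> Vzg; have /andP[zg0 zg1] := core_orbit_itv Vzg.
  move: Vzg => /core_orbit_sub; move: Uz => /andP[z0 z1].
  have /andP[g0 g1] := gap_bound k.
  by have [[gk _]|[gk _]] := gap_cases k; move=> [|[/andP[]|]]; lra.
move: (wordmap S w z) IHw
  (ex_intro _ w (ex_intro _ z (conj Uz erefl)) : core_orbit _) => y IHw Vy.
have /andP[y0 y1] := core_orbit_itv Vy.
have /andP[g0 g1] := gap_bound k.
move=> /core_orbit_cases[/andP[]|[j [v [Vv]]]].
  (* The sum cannot land in the core: it falls short of it for a point left of [(1 + b) / 7] and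
     leading digit [b], and overshoots it otherwise. *)
  have /andP[] := core_orbit_itv (core_orbit_S i Vy).
  have := core_orbit_sub (core_orbit_S i Vy).
  move: (S i y) => u.
  by have [[gk _]|[gk _]] := gap_cases k; move=> [|[/andP[]|]]; lra.
have /andP[v0 v1] := core_orbit_itv Vv.
(* Up to the factor 7 in the offsets, [v - y = 7 t_k + d_i - d_j] lies in []-1, 1[]. As
   [b + b / 6 > 1], this forces [d_i = 0] and [d_j = c_k], so [v = y + t_(k+1)]. *)
have := IHw k.+1; rewrite /equi /offset.
by case: i => [[|[|[|i]]] //= ?]; case: j => [[|[|[|j]]] //= ?];
  have [[gk ->]|[gk ->]] := gap_cases k => IH xE; try lra;
  apply: IH; rewrite (_ : y + _ = v)//; lra.
Qed.

Lemma core_orbit_open : open core_orbit.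
Proof.
have -> : core_orbit = \bigcup_w (wordmap S w @` core).
  apply/seteqP; split=> [x [w [y [Uy ->]]]|x [w _ [y Uy <-]]].
    by exists w => //; exists y.
  by exists w, y.
apply: bigcup_open => w _.
(* The explicit affine inverse of [wordmap S w] turns the image of the core into a continuous
   preimage. *)
have Sinv y : wordmap S w ((y - wordmap S w 0) * 7 ^+ size w) = y.
  have := wordmap_dist 7^-1 offset w ((y - wordmap S w 0) * 7 ^+ size w) 0.
  rewrite subr0 [_ * 7 ^+ _]mulrC mulrA -exprMn mulVf ?pnatr_eq0// expr1n mul1r.
  by move=> /(canRL (subrK _)) ->; rewrite subrK.
have -> : wordmap S w @` core = (fun y => (y - wordmap S w 0) * 7 ^+ size w) @^-1` core.
  apply/seteqP; split=> [_ [y Uy <-]|y Uy]; last by exists ((y - wordmap S w 0) * 7 ^+ size w).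
  by rewrite /= (bij_inj (bij_wordmap bij_S w) (Sinv (wordmap S w y))).
apply: open_comp => [y _|].
  by apply: cvgM; [apply: cvgB; [exact: cvg_id|exact: cvg_cst]|exact: cvg_cst].
rewrite (_ : core = `](2 + 2 * b) / 7, (5 - b) / 7[%classic); first exact: interval_open.
by apply/seteqP; split=> x /=; rewrite in_itv.
Qed.

Lemma core_orbit_osc : osc_for S core_orbit.
Proof.
have /andP[b0 b1] := digit_bound; split.
- exact: core_orbit_open.
- by exists ((7 + b) / 14), [::], ((7 + b) / 14); split=> //; apply/andP; split; lra.
- by move=> i _ [x Vx <-]; exact: core_orbit_S.
(* Only the images under the first two maps could meet; there [x = y + b = y + t_0], which
   [core_orbit_gap] excludes. *)
have disj (i j : 'I_3) x y : core_orbit x -> core_orbit y -> (i < j)%N ->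
    S i x = S j y -> False.
  move=> Vx Vy; have /andP[x0 x1] := core_orbit_itv Vx.
  have /andP[y0 y1] := core_orbit_itv Vy.
  have := @core_orbit_gap 0 y Vy; rewrite gap0 /equi /offset.
  case: i => [[|[|[|i]]] //= ?]; case: j => [[|[|[|j]]] //= ?] => Vyb _ xy; try lra.
  by apply: Vyb; rewrite (_ : y + b = x)//; lra.
move=> i j ij; apply/seteqP; split=> // _ [[x Vx <-] [y Vy yx]].
have [ji|ji|/val_inj ji] := ltngtP i j.
- exact: disj Vx Vy ji (esym yx).
- exact: disj Vy Vx ji yx.
- by rewrite ji eqxx in ij.
Qed.

End Example.

(** * Failure of the convex conditions *)

Lemma itv01_sub_convex_hull (R : realType) (K : set R) :
  K 0 -> K 1 -> `]0, 1[ `<=` (convex_hull K)°.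
Proof.
move=> K0 K1; rewrite -open_subsetE; last exact: interval_open.
move=> x; rewrite /= in_itv/= => /andP[x0 x1] C [Ccvx KC].
rewrite (_ : x = x * 1 + (1 - x) * 0); last by rewrite mulr1 mulr0 addr0.
exact/set_mem/(Ccvx 1 0 (Itv01 (ltW x0) (ltW x1)) (mem_set (KC _ K1)) (mem_set (KC _ K0))).
Qed.

(** Used with [M = 1], against the accumulation of the [t_k] at 1 from below. *)
Lemma finite_set_lt_sup (R : realType) (A : set R) (M : R) : finite_set A ->
  exists2 e, 0 < e & forall x, A x -> x < M -> x <= M - e.
Proof.
move=> /finite_seqP[s ->]; elim: s => [|y s [e e0 IHs]]; first by exists 1.
exists (if y < M then Num.min e (M - y) else e).
  by case: ifPn => // yM; rewrite lt_min e0 subr_gt0.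
move=> x /=; rewrite inE => /predU1P[->{x} yM|xs xM].
  by rewrite yM lerBrDr -lerBrDl ge_min lexx orbT.
apply: le_trans (IHs x xs xM) _; rewrite lerD2l lerN2.
by case: ifP => // _; rewrite ge_min lexx.
Qed.

Section ConvexConditions.
Context (R : realType).
Local Notation b := (digit R).
Local Notation S := (equi 7^-1 (offset R)).

Lemma not_osc_itv01 (V : set R) : `]0, 1[ `<=` V -> ~ osc_for S V.
Proof.
have /andP[b0 b1] := digit_bound R.
move=> V01 [_ _ _ /(_ (inord 0) (inord 1))].
rewrite -val_eqE/= !inordK// => /(_ isT) disj.
(* The midpoint of the overlap []b / 7, 1 / 7[] of the first two images of []0, 1[]. *)
have : set0 (7^-1 * ((1 + b) / 2) : R); last by [].
rewrite -disj; split.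
  exists ((1 + b) / 2); last by rewrite /equi /offset inordK//= addr0.
  by apply: V01; rewrite /= in_itv/=; apply/andP; split; lra.
exists ((1 - b) / 2); last by rewrite /equi /offset inordK//=; lra.
by apply: V01; rewrite /= in_itv/=; apply/andP; split; lra.
Qed.

(** Appending digit 0 to [w] and digit [c_k] to [v] turns the difference [t_k] into
    [7 t_k - c_k = t_(k+1)]. *)
Lemma gap_words k : exists v w : k.+1.-tuple 'I_3,
  forall x, wordmap S w x = wordmap S v (x + gap R k).
Proof.
elim: k => [|k [v [w vw]]].
  exists [tuple inord 0], [tuple inord 1] => x /=.
  by rewrite gap0 /equi /offset !inordK//=; lra.
have [i iE] : exists i, forall x, 7^-1 * x + gap R k = S i (x + gap R k.+1).
  have [[_ ->]|[_ ->]] := gap_cases R k; [exists (inord 1)|exists (inord 2)];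
    by move=> x; rewrite /equi /offset inordK//=; lra.
exists [tuple of rcons v i], [tuple of rcons w (inord 0)] => x /=.
rewrite -!cats1 !wordmap_cat /= vw -iE; congr (wordmap S v (_ + _)).
by rewrite /equi /offset inordK//= addr0.
Qed.

Lemma not_ftc_itv01 (V : set R) : `]0, 1[ `<=` V -> ~ ftc_for S V.
Proof.
move=> V01 [_ _ _ finT].
(* Finitely many types, each finite, leave only finitely many values at 0, that is, translation
   numbers. *)
have /(finite_set_lt_sup 1)[e e0 Te] : finite_set [set f 0 | f in
    \bigcup_(N in [set N | exists k (v : k.-tuple 'I_3), N = nbhd_type S V v]) N].
  apply: finite_image; apply: bigcup_finite => // _ [k [v ->]].
  exact: finite_image.
have [k ke] := gap_near1 e0; have /andP[g0 g1] := gap_bound R k.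
have /andP[b0 b1] := digit_bound R.
have [v [w vw]] := gap_words k.
have := Te (gap R k); apply: contraPP => _ /(_ _ g1) Tk.
have : gap R k <= 1 - e; last by rewrite leNgt ke.
apply: Tk; exists (relmap S v w); last first.
  by apply: relmap_eq; [exact: bij_S|rewrite vw add0r].
exists (nbhd_type S V v); first by exists k.+1, v.
(* This common point comes from [(1 + t_k) / 2], the midpoint of the overlap of []0, 1[] and its
   translate by [t_k]. *)
exists w => //; exists (wordmap S w ((1 - gap R k) / 2)); split.
  exists ((1 - gap R k) / 2 + gap R k); last by rewrite vw.
  by apply: V01; rewrite /= in_itv/=; apply/andP; split; lra.
exists ((1 - gap R k) / 2) => //.
by apply: V01; rewrite /= in_itv/=; apply/andP; split; lra.
Qed.

End ConvexConditions.

(** * Hausdorff dimension *)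

Section Hausdorff.
Context (R : realType).
Implicit Types (A K : set R) (s D : R).

Lemma diameter_ge0 A : (0 <= diameter A)%E.
Proof. by apply: ereal_sup_ubound; left. Qed.

Lemma diameter_ub A x y : A x -> A y -> (`|x - y|%:E <= diameter A)%E.
Proof. by move=> Ax Ay; apply: ereal_sup_ubound; right; exists x => //; exists y. Qed.

Lemma diameter_le A D : 0 <= D -> (forall x y, A x -> A y -> `|x - y| <= D) ->
  (diameter A <= D%:E)%E.
Proof.
move=> D0 AD; apply: ge_ereal_sup => _ [->|[x Ax [y Ay <-]]]; rewrite lee_fin//.
exact: AD.
Qed.

Lemma hausdorff_weight_ge0 s A : (0 <= hausdorff_weight s A)%E.
Proof. by rewrite /hausdorff_weight; case: ifP => // _; exact: poweR_ge0. Qed.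

Lemma hausdorff_weight_le s D A : 0 <= s -> (diameter A <= D%:E)%E ->
  (hausdorff_weight s A <= (D `^ s)%:E)%E.
Proof.
move=> s0 AD; rewrite /hausdorff_weight; case: ifP => _; first by rewrite lee_fin powR_ge0.
rewrite -poweR_EFin; apply: gt0_ler_poweR => //; rewrite in_itv/= leey andbT.
  exact: diameter_ge0.
exact: le_trans (diameter_ge0 A) AD.
Qed.

Lemma hausdorff_premeasure_ge0 s D A : (0 <= hausdorff_premeasure s D A)%E.
Proof.
apply/ereal_infP => _ [F _ <-]; apply: nneseries_ge0 => k _ _.
exact: hausdorff_weight_ge0.
Qed.

Lemma hausdorff_premeasure_finite_cover s D A (N : nat) (G : nat -> set R) (M : R) :
  0 <= s -> 0 <= M <= D -> A `<=` \bigcup_(k < N) G k ->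
  (forall k, (diameter (G k) <= M%:E)%E) ->
  (hausdorff_premeasure s D A <= (N%:R * M `^ s)%:E)%E.
Proof.
move=> s0 /andP[M0 MD] AG GM; apply: ge_ereal_inf.
exists (\sum_(k <oo) hausdorff_weight s (if (k < N)%N then G k else set0))%E.
  exists (fun k => if (k < N)%N then G k else set0) => //; split=> [x /AG[k /= kN Gx]|k].
    by exists k => //; rewrite kN.
  case: ifP => _; first by rewrite (le_trans (GM k))// lee_fin.
  by apply: diameter_le => //; exact: le_trans MD.
rewrite (nneseries_split 0 N) => [|k _]; last exact: hausdorff_weight_ge0.
rewrite add0n eseries0 => [|k Nk _]; last first.
  by rewrite ltnNge Nk/= /hausdorff_weight asboolT.
rewrite adde0 big_mkord.
apply: (@le_trans _ _ (\sum_(k < N) (M `^ s)%:E)%E).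
  apply: lee_sum => k _; rewrite ltn_ord; exact: hausdorff_weight_le.
by rewrite sumEFin sumr_const card_ord mulr_natl.
Qed.

Lemma hausdorff_measure_limit_set (n : nat) (r : R) (d : 'I_n -> R) s :
  (0 < n)%N -> 0 < r -> r < 1 -> (forall i, 0 <= d i <= 1 - r) ->
  0 <= s -> n%:R * r `^ s < 1 ->
  hausdorff_measure s (limit_set (equi r d)) = 0%E.
Proof.
move=> n0 r0 r1 d01 s0 q1; set S := equi r d; set q := n%:R * r `^ s in q1.
have q0 : 0 < q by rewrite mulr_gt0 ?powR_gt0// ltr0n.
have bound k D : r ^+ k <= D -> (hausdorff_premeasure s D (limit_set S) <= (q ^+ k)%:E)%E.
  move=> rD; pose words := [seq tval w | w : k.-tuple 'I_n].
  have -> : q ^+ k = (n ^ k)%:R * (r ^+ k) `^ s.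
    rewrite /q exprMn natrX; congr (_ * _).
    by rewrite -(powR_mulrn k (powR_ge0 r s)) -(powR_mulrn k (ltW r0)) powRAC.
  have sw : size words = (n ^ k)%N by rewrite size_map -cardT card_tuple card_ord.
  (* The default word also has length k, so the diameter bound holds for every index. *)
  apply: (@hausdorff_premeasure_finite_cover _ _ _ _
    (fun j => wordmap S (nth (nseq k (Ordinal n0)) words j) @` `[0, 1])) => //.
  - by rewrite exprn_ge0// ltW.
  - move=> x Kx; have [w [y [wk y01 xE]]] := limit_set_addressed (Kx k I).
    have wwords : w \in words.
      by apply/mapP; exists (tcast wk (in_tuple w)); rewrite ?mem_enum// val_tcast.
    exists (index w words); first by rewrite /= -sw index_mem.
    by exists y => //; rewrite nth_index.
  move=> j; apply: diameter_le => [|_ _ [x x01 <-] [y y01 <-]].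
    by rewrite exprn_ge0// ltW.
  rewrite wordmap_dist normrM ger0_norm ?exprn_ge0 ?(ltW r0)//.
  have -> : size (nth (nseq k (Ordinal n0)) words j) = k.
    have [jw|jw] := ltnP j (size words); last by rewrite nth_default// size_nseq.
    by have /mapP[w _ ->] := mem_nth (nseq k (Ordinal n0)) jw; rewrite size_tuple.
  rewrite -[leRHS]mulr1; apply: ler_wpM2l; first by rewrite exprn_ge0// ltW.
  move: x01 y01; rewrite /= !in_itv/= => /andP[? ?] /andP[? ?].
  by rewrite ler_norml; apply/andP; split; lra.
apply/eqP; rewrite eq_le; apply/andP; split; last first.
  apply: le_trans (hausdorff_premeasure_ge0 s 1 _) _.
  by apply: ereal_sup_ubound; exists 1 => //=.
apply: ge_ereal_sup => _ [D /= D0 <-]; apply/lee_addgt0Pr => e e0; rewrite add0e.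
have [k1 Dk] := expr_lt_eps r0 r1 1 D0; have [k2 ek] := expr_lt_eps q0 q1 1 e0.
rewrite !mulr1 in Dk ek.
apply: le_trans (bound (maxn k1 k2) D _) _; rewrite ?lee_fin.
  by rewrite (le_trans _ (ltW Dk))// ler_wiXn2l ?leq_maxl ?ltW.
by rewrite (le_trans _ (ltW ek))// ler_wiXn2l ?leq_maxr ?ltW.
Qed.

End Hausdorff.

(** * Lower bound on the dimension by a Cantor subset *)

Section Cantor.
Context (R : realType).
Implicit Types x y : R.

Definition bit y : R := (1 / 2 <= y)%R%:R.

Definition doubling y : R := 2 * y - bit y.

(** The binary digits of [y], multiplied by 6 and read in base 7: only the first and third maps are
    used. *)
Definition cantor y : R := adic (fun k => 6 * bit (iter k doubling y)).

Let digits_bound y k : 0 <= 6 * bit (iter k doubling y) <= 6.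
Proof. by rewrite /bit; case: (leP (1 / 2)) => _ /=; apply/andP; split; lra. Qed.

Lemma cantor_rec y : cantor y = (6 * bit y + cantor (doubling y)) / 7.
Proof.
rewrite /cantor (adic_rec (digits_bound y)); congr ((_ + adic _) / _).
by apply/funext => k; rewrite /shift add1n iterSr.
Qed.

Lemma cantor_bound y : 0 <= cantor y <= 1.
Proof. by have := adic_bound (digits_bound y); rewrite divff// pnatr_eq0. Qed.

Lemma bit01 y : (bit y = 0 /\ y < 1 / 2) \/ (bit y = 1 /\ 1 / 2 <= y).
Proof.
by rewrite /bit; case: (leP (1 / 2)) => ? /=; [right|left];
  rewrite ?mulr1n ?mulr0n.
Qed.

Lemma doubling_bound y : 0 <= y <= 1 -> 0 <= doubling y <= 1.
Proof.
move=> /andP[y0 y1]; rewrite /doubling.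
by have [[-> ?]|[-> ?]] := bit01 y; apply/andP; split; lra.
Qed.

Lemma cantor_limit_set y : limit_set (equi 7^-1 (offset R)) (cantor y).
Proof.
move=> k _; elim: k y => [|k IHk] y; first by rewrite /= in_itv/=; exact: cantor_bound.
apply/levelS.
have [[by_ _]|[by_ _]] := bit01 y; [exists (inord 0)|exists (inord 2)];
  exists (cantor (doubling y)); split => //;
  by rewrite cantor_rec by_ /offset inordK//=; lra.
Qed.

(* Hoelder continuity of the inverse: the exponent is [1/3] since [7 <= 2 ^ 3]. *)
Lemma cantor_inv_hoelder x y : 0 <= x <= 1 -> 0 <= y <= 1 ->
  `|x - y| ^+ 3 <= 2 * `|cantor x - cantor y|.
Proof.
move=> x01 y01.
(* Comparing k digits leaves an error [8^-1 ^+ k]. An equal digit divides the left side by 8 and the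
   distance of images by 7; at the first differing digit the images are at least 5/7 apart. *)
have approx k : `|x - y| ^+ 3 <= 2 * `|cantor x - cantor y| + 8^-1 ^+ k.
  elim: k x y x01 y01 => [|k IHk] x y x01 y01.
    rewrite expr0 (@le_trans _ _ 1)//; last by rewrite lerDr mulr_ge0.
    rewrite exprn_ile1// ler_norml.
    by move: x01 y01 => /andP[? ?] /andP[? ?]; apply/andP; split; lra.
  have := IHk _ _ (doubling_bound x01) (doubling_bound y01).
  have same c : bit x = c -> bit y = c ->
      `|doubling x - doubling y| ^+ 3 <=
        2 * `|cantor (doubling x) - cantor (doubling y)| + 8^-1 ^+ k ->
      `|x - y| ^+ 3 <= 2 * `|cantor x - cantor y| + 8^-1 ^+ k.+1.
    move=> xc yc; rewrite (cantor_rec x) (cantor_rec y) /doubling xc yc.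
    have -> : 2 * x - c - (2 * y - c) = 2 * (x - y) by ring.
    set u := cantor _; set v := cantor _.
    have -> : (6 * c + u) / 7 - (6 * c + v) / 7 = (u - v) / 7 by field.
    rewrite !normrM [`|2|]ger0_norm// [`|7^-1|]ger0_norm// exprMn (exprS 8^-1).
    by have := normr_ge0 (u - v); lra.
  have diff : 5 / 7 <= `|cantor x - cantor y| ->
      `|x - y| ^+ 3 <= 2 * `|cantor x - cantor y| + 8^-1 ^+ k.+1.
    move=> cxy; rewrite (@le_trans _ _ 1)//.
      rewrite exprn_ile1// ler_norml.
      by move: x01 y01 => /andP[? ?] /andP[? ?]; apply/andP; split; lra.
    have : 0 <= 8^-1 ^+ k.+1 :> R by rewrite exprn_ge0.
    by lra.
  have /andP[u0 u1] := cantor_bound (doubling x).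
  have /andP[v0 v1] := cantor_bound (doubling y).
  have [[xb _]|[xb _]] := bit01 x; have [[yb _]|[yb _]] := bit01 y.
  - exact: same xb yb.
  - move=> _; apply: diff; rewrite (cantor_rec x) (cantor_rec y) xb yb.
    by rewrite ler_normr; apply/orP; right; lra.
  - move=> _; apply: diff; rewrite (cantor_rec x) (cantor_rec y) xb yb.
    by rewrite ler_normr; apply/orP; left; lra.
  - exact: same xb yb.
apply/ler_addgt0Pr => e e0.
have [||k ke] := @expr_lt_eps R 8^-1 _ _ 1 e e0; [lra|lra|].
by rewrite (le_trans (approx k))// lerD2l ltW// -[ltLHS]mulr1.
Qed.

(** For [D <= 1], lowering the exponent from 1/3 to [s] only increases the power. *)
Lemma root3_le_powR (s D a : R) : 0 <= s <= 1 / 3 -> 0 <= D <= 1 -> 0 <= a ->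
  a ^+ 3 <= 2 * D -> a <= 2 * D `^ s.
Proof.
move=> /andP[s0 s1] /andP[D0 D1] a0 aD.
have [D00|Dn0] := eqVneq D 0.
  move: aD; rewrite D00 mulr0 => a3; suff -> : a = 0 by rewrite mulr_ge0// powR_ge0.
  have : a ^+ 3 == 0 by rewrite eq_le a3 exprn_ge0.
  by rewrite expf_eq0 => /andP[_ /eqP].
have Dgt0 : 0 < D by rewrite lt_neqAle eq_sym Dn0.
apply: (@le_trans _ _ (2 * D `^ (1 / 3))); last first.
  by rewrite ler_pM2l//; apply: ger_powR => //; rewrite Dgt0 D1.
rewrite -(@ler_pXn2r _ 3)// ?nnegrE ?mulr_ge0 ?powR_ge0// exprMn.
rewrite -(powR_mulrn 3 (powR_ge0 D (1 / 3))) -powRrM divfK ?pnatr_eq0// powRr1//.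
by rewrite (le_trans aD)//; lra.
Qed.

(** Mass distribution: a cover of the limit set pulls back along [cantor] to a cover of [[0, 1]],
    whose pieces lie in intervals of length at most 4 times the weights; these lengths add up to at
    least 1. *)
Lemma hausdorff_premeasure_cantor (s : R) : 0 <= s <= 1 / 3 ->
  ((1 / 4)%:E <= hausdorff_premeasure s 1 (limit_set (equi 7^-1 (offset R))))%E.
Proof.
move=> s01; apply/ereal_infP => _ [F [KF F1] <-].
pose E k := [set y : R | 0 <= y <= 1 /\ F k (cantor y)].
have /choice[J JP] k : exists J : set R, [/\ measurable J, E k `<=` J &
    (lebesgue_measure J <= 4%:E * hausdorff_weight s (F k))%E].
  have [[y0 Ey0]|Ek0] := pselect (E k !=set0); last first.
    exists set0; split=> //; first by move=> y Ey; case: Ek0; exists y.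
    by rewrite measure0 mule_ge0// hausdorff_weight_ge0.
  have [y001 Fy0] := Ey0.
  have [D D01 FD] : exists2 D, 0 <= D <= 1 & diameter (F k) = D%:E.
    have := diameter_ge0 (F k); have := F1 k.
    by case: (diameter (F k)) => // D; rewrite !lee_fin => D1 D0; exists D; rewrite ?D0.
  exists `[y0 - 2 * D `^ s, y0 + 2 * D `^ s]%classic; split=> //.
    move=> y [y01 Fy]; rewrite /= in_itv/= -ler_distl.
    apply: root3_le_powR => //.
    apply: le_trans (cantor_inv_hoelder y01 y001) _.
    by rewrite ler_pM2l// -lee_fin -FD; exact: diameter_ub.
  have -> : hausdorff_weight s (F k) = (D `^ s)%:E.
    by rewrite /hausdorff_weight FD asboolF//; move=> F0; rewrite F0 in Fy0.
  rewrite lebesgue_measure_itv/= lte_fin; case: ifPn => _; last first.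
    by rewrite mule_ge0// lee_fin powR_ge0.
  by rewrite -EFinB -EFinM lee_fin; lra.
have : (lebesgue_measure (`[0%R, 1%R]%classic : set R) <=
    \sum_(k <oo) lebesgue_measure (J k))%E.
  apply: measure_sigma_subadditive => //; first by move=> k; have [] := JP k.
  move=> y; rewrite /= in_itv/= => y01.
  have [k _ Fk] := KF _ (cantor_limit_set y).
  by exists k => //; have [_ + _] := JP k; apply.
rewrite lebesgue_measure_itv/= lte_fin ltr01 oppr0 adde0 => le1.
rewrite -(@lee_pmul2l _ 4%:E)//.
apply: (@le_trans _ _ 1%:E); first by rewrite -EFinM lee_fin; lra.
apply: le_trans le1 _; rewrite -nneseriesZl => [|k _]; last exact: hausdorff_weight_ge0.
by apply: lee_nneseries => [k _ _|k _]; [exact: measure_ge0|have [] := JP k].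
Qed.

End Cantor.

(** * Dimension bounds for the example *)

Section Dimension.
Context (R : realType).
Local Notation K := (limit_set (equi 7^-1 (offset R))).

Lemma offset_bound i : 0 <= offset R i <= 1 - 7^-1.
Proof.
have /andP[b0 b1] := digit_bound R.
by case: i => [[|[|[|i]]] //= ?]; rewrite /offset/=; apply/andP; split; lra.
Qed.

Lemma hausdorff_dim_lt1 : (hausdorff_dim K < 1)%E.
Proof.
(* [3 / 5] exceeds log 3 / log 7, since [3 ^ 5 = 243 < 343 = 7 ^ 3]. *)
apply: (@le_lt_trans _ _ (3 / 5)%:E); last by rewrite lte_fin; lra.
apply: ereal_inf_lbound; exists (3 / 5) => //; split; first by lra.
apply: hausdorff_measure_limit_set => //; [lra|exact: offset_bound|].
rewrite ltNge; apply/negP => /exprn_ege1 - /(_ 5); rewrite leNgt => /negP; apply.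
rewrite exprMn -(powR_mulrn 5 (powR_ge0 _ _)) -powRrM divfK ?pnatr_eq0//.
by rewrite powR_mulrn//; lra.
Qed.

Lemma hausdorff_dim_gt0 : (0 < hausdorff_dim K)%E.
Proof.
apply: (@lt_le_trans _ _ (1 / 3)%:E); first by rewrite lte_fin; lra.
apply/ereal_infP => _ [s [s0 Ks] <-]; rewrite lee_fin leNgt; apply/negP => s1.
have /hausdorff_premeasure_cantor : 0 <= s <= 1 / 3 by rewrite s0 ltW.
apply/negP; rewrite -ltNge.
apply: (@le_lt_trans _ _ (hausdorff_measure s K)).
  by apply: ereal_sup_ubound; exists 1 => //=.
by rewrite Ks lte_fin; lra.
Qed.

End Dimension.

Theorem mainTheorem1 (R : realType) :
  exists a : R,
  let S (i : 'I_3) (x : R) : R :=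
    match nat_of_ord i with
    | 0 => x / 7
    | 1 => x / 7 + a
    | _ => x / 7 + 6 / 7
    end in
  exists K : set R,
  attractor S K /\
  [/\ [/\ K 0, K 1, K `<=` `[0, 1], K <> `[0, 1]%classic
        & (0 < hausdorff_dim K < 1)%E],
      [/\ weak_separation S, open_set_condition S & finite_type_condition S],
      ~ convex_open_set_condition S K
    & ~ convex_finite_type_condition S K].
Proof.
exists (digit R / 7) => S.
have -> : S = equi 7^-1 (offset R).
  apply/funext => i; apply/funext => x; rewrite /S /equi /offset.
  by case: i => [[|[|[|i]]] //= ?]; rewrite mulrC ?addr0.
have /andP[b0 b1] := digit_bound R.
have r0 : 0 < 7^-1 :> R by lra.
have r1 : 7^-1 < 1 :> R by lra.
pose K := limit_set (equi 7^-1 (offset R)).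
have Kfix (c : R) i : 0 <= c <= 1 -> 7^-1 * c + offset R i = c -> K c.
  move=> c01 cE k _; elim: k => [|k IHk]; first by rewrite /= in_itv.
  by apply/levelS; exists i, c.
have K0 : K 0 by apply: (@Kfix 0 (inord 0)); rewrite ?lexx ?ler01// /offset inordK//=; lra.
have K1 : K 1 by apply: (@Kfix 1 (inord 2)); rewrite ?lexx ?ler01// /offset inordK//=; lra.
have hullK := itv01_sub_convex_hull K0 K1.
exists K; split.
  by apply: limit_set_attractor => //; [exact: offset_bound|exists 0].
split.
- split=> //.
  + exact: limit_set_sub01.
  (* The point [1 / 2] lies between [I_2] and [I_3], hence outside level 1. *)
  + move=> KE; have : K (1 / 2) by rewrite KE /= in_itv/=; apply/andP; split; lra.
    move=> /(_ 1%N I)/levelS[i [y []]]; rewrite /= in_itv/= => /andP[y0 y1].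
    by case: i => [[|[|[|i]]] //= ?]; rewrite /offset/=; lra.
  + by rewrite hausdorff_dim_gt0 hausdorff_dim_lt1.
- have oscV := core_orbit_osc R; split.
  + exact: osc_wsp (@bij_S R) oscV.
  + by exists (@core_orbit R).
  + by exists (@core_orbit R); exact: osc_ftc (@bij_S R) oscV.
- exact: not_osc_itv01.
- exact: not_ftc_itv01.
Qed.
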